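(* Let $G$ be a small groupoid, let $S$ be a ring epsilon-strongly graded by $G$, put $R=\oplus_{e\in G_0}S_e$, and for $g\in G_1$ let $\epsilon_g$ be the multiplicative identity element of $S_gS_{g^{-1}}$ (a central idempotent of $R$). Then for all $(g,h)\in G_2$ the following assertions hold. (a) For every graded left $S$-module $M$, the multiplication map $m_{g,h}:S_g\otimes_{S_{d(g)}}M_h\to\epsilon_gM_{gh}$ is an isomorphism of left $R$-modules. (b) For every graded right $S$-module $M$, the multiplication map $m'_{g,h}:M_g\otimes_{S_{d(g)}}S_h\to M_{gh}\epsilon_{h^{-1}}$ is an isomorphism of right $R$-modules. (c) The multiplication map $m_{g,h}:S_g\otimes_RS_h\to\epsilon_gS_{gh}=S_{gh}\epsilon_{h^{-1}}$ is an isomorphism of $R$-bimodules. (d) For every $g\in G_1$, the sextuple $(\epsilon_gR,\epsilon_{g^{-1}}R,S_g,S_{g^{-1}},m_{g,g^{-1}},m_{g^{-1},g})$ is a set of equivalence data.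
   Context: Rings are associative and unital; the zero ring is allowed, with identity $0$. For the groupoid $G$: $G_0$ objects (identified with identity morphisms), $G_1$ morphisms, $d(g),c(g)$ domain and codomain, $G_2=\{(g,h): d(g)=c(h)\}$ composable pairs with composite $gh$. For additive subgroups, $XY$ denotes the set of finite sums of products $xy$. A ring $S$ is $G$-graded if $S=\oplus_{g\in G_1}S_g$ for additive subgroups $S_g$ with $S_gS_h\subseteq S_{gh}$ if $(g,h)\in G_2$ and $S_gS_h=\{0\}$ otherwise. It is epsilon-strongly graded by $G$ if for each $g\in G_1$, $S_gS_{g^{-1}}$ is a unital ideal of $S_{c(g)}$ (an ideal having a multiplicative identity), and for all $(g,h)\in G_2$, $S_gS_h=S_gS_{g^{-1}}S_{gh}=S_{gh}S_{h^{-1}}S_h$. Then $S_gS_{g^{-1}}=\epsilon_gS_{c(g)}=\epsilon_gR$. A graded left (right) $S$-module $M$ is a left (right) $S$-module with additive subgroups $M_g$, $g\in G_1$, such that $M=\oplus_{g\in G_1}M_g$ and, for all $g,h\in G_1$, $S_gM_h\subseteq M_{gh}$ (respectively $M_gS_h\subseteq M_{gh}$) if $(g,h)\in G_2$, and $S_gM_h=\{0\}$ (respectively $M_gS_h=\{0\}$) otherwise. A set of equivalence data $(I,J,P,Q,\alpha,\beta)$ consists of rings $I,J$, an $I$-$J$-bimodule $P$, a $J$-$I$-bimodule $Q$, an $I$-bimodule isomorphism $\alpha:P\otimes_JQ\to I$ and a $J$-bimodule isomorphism $\beta:Q\otimes_IP\to J$ with $\alpha(p\otimes q)p'=p\beta(q\otimes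 p')$ and $\beta(q\otimes p)q'=q\alpha(p\otimes q')$ for all $p,p'\in P$, $q,q'\in Q$. In (d), the tensor products over $\epsilon_{g^{-1}}R$ and $\epsilon_gR$ are identified with those over $R$, and $m_{g,g^{-1}}:S_g\otimes_RS_{g^{-1}}\to\epsilon_gS_{c(g)}=\epsilon_gR$. *)

(* Defs.v *)
From HB Require Import structures.
From mathcomp Require Import all_boot all_algebra.
From mathcomp Require Import boolp.
From mathcomp.multinomials Require Import freeg.

Set Implicit Arguments.
Unset Strict Implicit.
Unset Printing Implicit Defensive.

Import GRing.Theory.
Local Open Scope ring_scope.
Local Open Scope quotient_scope.

(* Right A-modules are left modules over the converse ring A^c.  The zero ring
   is allowed throughout, hence [pzRingType]. *)
Notation rmodType A := (lmodType A^c).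

Definition racts (A : pzRingType) (X : rmodType A) (x : X) (a : A) : X :=
  (a : A^c) *: x.
Notation "x *:r a" := (racts x a) (at level 40, left associativity).

Section RightModules.
Variables (A : pzRingType) (X : rmodType A).
Implicit Types (x : X) (a : A).

Lemma ractsA x a b : x *:r a *:r b = x *:r (a * b).
Proof. exact: scalerA. Qed.
Lemma racts1 x : x *:r (1 : A) = x.
Proof. exact: scale1r. Qed.
Lemma ractsDl x y a : (x + y) *:r a = x *:r a + y *:r a.
Proof. exact: scalerDr. Qed.
Lemma ractsDr x a b : x *:r (a + b) = x *:r a + x *:r b.
Proof. exact: scalerDl. Qed.
Lemma ractsBl x y a : (x - y) *:r a = x *:r a - y *:r a.
Proof. exact: scalerBr. Qed.
End RightModules.

Record bimodule (A B : pzRingType) := Bimodule {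
  bim_left :> lmodType A;
  bract : bim_left -> B -> bim_left;
  bractA : forall x b c, bract (bract x b) c = bract x (b * c);
  bract1 : forall x, bract x 1 = x;
  bractDl : forall x y b, bract (x + y) b = bract x b + bract y b;
  bractDr : forall x b c, bract x (b + c) = bract x b + bract x c;
  bractZ : forall a x b, bract (a *: x) b = a *: bract x b }.

Section BimoduleRight.
Variables (A B : pzRingType) (P : bimodule A B).
Let op (b : B^c) (x : P) : P := bract x b.
Let opA b c x : op b (op c x) = op (b * c) x.
Proof. exact: bractA. Qed.
Let op1 : left_id 1 op.
Proof. exact: bract1. Qed.
Let opDr : right_distributive op +%R.
Proof. by move=> b x y; apply: bractDl. Qed.
Let opDl x : {morph op^~ x : b c / b + c}.
Proof. by move=> b c; apply: bractDr. Qed.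

Definition bim_right_mixin :=
  GRing.Zmodule_isLmodule.Build B^c (P : zmodType) opA op1 opDr opDl.
Definition bim_right : rmodType B :=
  HB.pack (P : zmodType) bim_right_mixin.
End BimoduleRight.

Definition regular_bimodule (A : pzRingType) : bimodule A A :=
  @Bimodule A A A^o (fun x b => (x : A) * b)
    (fun x b c => esym (mulrA _ _ _)) (@mulr1 A)
    (fun x y b => mulrDl _ _ _) (fun x b c => mulrDr _ _ _)
    (fun a x b => esym (mulrA _ _ _)).

Definition lmod_iso (A : pzRingType) (V W : lmodType A) (f : V -> W) : Prop :=
  linear f /\ bijective f.

Definition rmod_iso (A : pzRingType) (V W : rmodType A) (f : V -> W) : Prop :=
  [/\ {morph f : x y / x + y}, forall x (a : A), f (x *:r a) = f x *:r a
    & bijective f].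

Definition bimod_iso (A B : pzRingType) (V W : bimodule A B) (f : V -> W) :=
  [/\ linear f, forall x (b : B), f (bract x b) = bract (f x) b & bijective f].

Section Tensor.
Variables (A : pzRingType) (X : rmodType A) (Y : lmodType A).
Local Notation F := {freeg (X * Y)%type}.

Inductive tensor_relator : F -> Prop :=
| TensorDl x x' y :
    tensor_relator (<<(x + x', y)>> - (<<(x, y)>> + <<(x', y)>>))
| TensorDr x y y' :
    tensor_relator (<<(x, y + y')>> - (<<(x, y)>> + <<(x, y')>>))
| TensorM x (a : A) y :
    tensor_relator (<<(x *:r a, y)>> - <<(x, a *: y)>>).

(* The subgroup generated by the relators: the intersection of all subgroups
   containing them. *)
Definition tensor_null : {pred F} := fun z =>
  `[< forall N : zmodClosed F, (forall r, tensor_relator r -> r \in N) ->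
        z \in N >].

Fact tensor_null_zmod : zmod_closed tensor_null.
Proof.
split=> [|u v /asboolP Hu /asboolP Hv].
  by apply/asboolP=> N _; apply: rpred0.
by apply/asboolP=> N HN; rewrite rpredB ?Hu ?Hv.
Qed.
HB.instance Definition _ := GRing.isZmodClosed.Build F tensor_null
  tensor_null_zmod.

Definition tensor : zmodType := Quotient.quot tensor_null.

Definition tens (x : X) (y : Y) : tensor :=
  \pi_(Quotient.quot tensor_null) <<(x, y)>>.

Record balanced (Z : zmodType) := Balanced {
  bal_fun :> X -> Y -> Z;
  balDl : forall x x' y, bal_fun (x + x') y = bal_fun x y + bal_fun x' y;
  balDr : forall x y y', bal_fun x (y + y') = bal_fun x y + bal_fun x y';
  balM : forall x (a : A) y, bal_fun (x *:r a) y = bal_fun x (a *: y) }.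

Definition tensor_lift (Z : zmodType) (b : balanced Z) (t : tensor) : Z :=
  \sum_(p <- fgenum (repr t : F)) b p.2.1 p.2.2 *~ p.1.

Section Lift.
Variables (Z : zmodType) (b : balanced Z).

Let free_lift (z : F) : Z := \sum_(p <- fgenum z) b p.2.1 p.2.2 *~ p.1.

Let free_liftE z :
  free_lift z = fglift (fun p => b p.1 p.2 : zmodule Z) z.
Proof. by rewrite -{2}[z]Freeg_enum fglift_Freeg /prelift /free_lift. Qed.

Let free_lift_zmod : zmod_morphism free_lift.
Proof. by move=> u v; rewrite !free_liftE lift_is_additive. Qed.

HB.instance Definition _ := GRing.isZmodMorphism.Build F Z free_lift
  free_lift_zmod.

Let free_liftD u v : free_lift (u + v) = free_lift u + free_lift v.
Proof. exact: raddfD. Qed.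

Let free_liftU x y : free_lift <<(x, y)>> = b x y.
Proof. by rewrite free_liftE liftU scale1r. Qed.

Let ker : {pred F} := fun z => free_lift z == 0.
Let ker_zmod : zmod_closed ker.
Proof.
split=> [|u v]; rewrite !unfold_in ?raddf0 //.
by move=> /eqP Hu /eqP Hv; rewrite /ker free_lift_zmod Hu Hv subr0.
Qed.
HB.instance Definition _ := GRing.isZmodClosed.Build F ker ker_zmod.

Let free_lift_null z : z \in tensor_null -> free_lift z = 0.
Proof.
move=> /asboolP /(_ ker) H; apply/eqP; apply: H => r.
case=> [x x' y|x y y'|x a y]; rewrite unfold_in /ker free_lift_zmod;
  rewrite ?free_liftD !free_liftU.
- by rewrite balDl subrr.
- by rewrite balDr subrr.
- by rewrite balM subrr.
Qed.

Let lift_pi z : tensor_lift b (\pi_(Quotient.quot tensor_null) z) = free_lift z.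
Proof.
apply/eqP; rewrite -subr_eq0 -[tensor_lift _ _]/(free_lift _) -free_lift_zmod.
apply/eqP/free_lift_null; rewrite Quotient.idealrBE.
by rewrite reprK.
Qed.

Lemma tensor_lift_is_zmod_morphism : zmod_morphism (tensor_lift b).
Proof.
move=> u v; rewrite -[u]reprK -[v]reprK -raddfB !lift_pi.
exact: free_lift_zmod.
Qed.
HB.instance Definition _ := GRing.isZmodMorphism.Build tensor Z (tensor_lift b)
  tensor_lift_is_zmod_morphism.

Lemma tensor_liftE x y : tensor_lift b (tens x y) = b x y.
Proof. by rewrite /tens lift_pi free_liftU. Qed.
End Lift.

Local Notation pi := (\pi_(Quotient.quot tensor_null)).

Let piB u v : pi (u - v) = (pi u - pi v : tensor).
Proof. exact: raddfB. Qed.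
Let piD u v : pi (u + v) = (pi u + pi v : tensor).
Proof. exact: raddfD. Qed.

Let pi_relator u v : tensor_relator (u - v) -> pi u = pi v :> tensor.
Proof.
move=> uv; apply/eqP; rewrite -Quotient.idealrBE.
by apply/asboolP=> N; apply.
Qed.

Lemma tensDl x x' y : tens (x + x') y = tens x y + tens x' y.
Proof. by rewrite -piD; apply: pi_relator; constructor. Qed.
Lemma tensDr x y y' : tens x (y + y') = tens x y + tens x y'.
Proof. by rewrite -piD; apply: pi_relator; constructor. Qed.
Lemma tensM x (a : A) y : tens (x *:r a) y = tens x (a *: y).
Proof. by apply: pi_relator; constructor. Qed.

Lemma tens0l y : tens 0 y = 0.
Proof. by apply: (addrI (tens 0 y)); rewrite -tensDl !addr0. Qed.
Lemma tensNl x y : tens (- x) y = - tens x y.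
Proof. by apply/eqP; rewrite -addr_eq0 -tensDl addNr tens0l. Qed.

Lemma tensor_gen t : exists s : seq (X * Y), t = \sum_(p <- s) tens p.1 p.2.
Proof.
rewrite -[t]reprK -[repr t]Freeg_enum; move: (fgenum _).
elim=> [|[k [x y]] l [s IH]].
  exists [::]; rewrite big_nil -[RHS](subrr (pi 0 : tensor)) -piB subrr.
  by rewrite freeg_nil.
have -> : Freeg ((k, (x, y)) :: l) = <<(x, y)>> *~ k + Freeg l :> F.
  by rewrite -cat1s freeg_cat freegU_mulz intz.
rewrite piD IH.
suff [s' ->] : exists s', pi (<<(x, y)>> *~ k) = \sum_(p <- s') tens p.1 p.2.
  by exists (s' ++ s); rewrite big_cat.
have -> : pi (<<(x, y)>> *~ k) = tens x y *~ k by apply: raddfMz.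
case: k => n.
  by exists (nseq n (x, y)); rewrite big_nseq iter_addr_0.
exists (nseq n.+1 (- x, y)).
by rewrite big_nseq iter_addr_0 /= tensNl NegzE mulrNz mulNrn.
Qed.

Lemma tensor_ext (Z : zmodType) (f g : tensor -> Z) :
  {morph f : x y / x + y} -> {morph g : x y / x + y} ->
  (forall x y, f (tens x y) = g (tens x y)) -> f =1 g.
Proof.
move=> fD gD fg t; have [s ->] := tensor_gen t.
have zero (h : tensor -> Z) : {morph h : x y / x + y} -> h 0 = 0.
  by move=> hD; apply: (addrI (h 0)); rewrite -hD !addr0.
elim: s => [|p s IH]; first by rewrite big_nil !zero.
by rewrite big_cons fD gD IH fg.
Qed.
End Tensor.

Section TensorLeft.
Variables (B A : pzRingType) (P : bimodule B A) (Y : lmodType A).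
Notation PY := (tensor (bim_right P) Y).

Let lbal (b : B) : balanced (bim_right P) Y PY.
Proof.
exists (fun x y => tens (b *: (x : P) : bim_right P) y)
  => [x x' y|x y y'|x a y].
- by rewrite -tensDl; congr tens; exact: (@scalerDr _ (bim_left P)).
- by rewrite -tensDr.
- by rewrite -tensM; congr tens; apply: esym; apply: bractZ.
Defined.

Definition ltensor_act (b : B) (t : PY) : PY := tensor_lift (lbal b) t.

Lemma ltensor_actE b (x : bim_right P) y :
  ltensor_act b (tens x y) = tens (b *: (x : P) : bim_right P) y.
Proof. exact: tensor_liftE. Qed.

Let actD b : {morph ltensor_act b : x y / x + y}.
Proof. exact: raddfD. Qed.

Let actA b c t : ltensor_act b (ltensor_act c t) = ltensor_act (b * c) t.
Proof.
move: t; apply: tensor_ext => [u v|u v|x y]; rewrite ?actD //.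
by rewrite !ltensor_actE scalerA.
Qed.
Let act1 : left_id 1 ltensor_act.
Proof.
by apply: tensor_ext => [u v|u v|x y]; rewrite ?actD ?ltensor_actE ?scale1r.
Qed.
Let actDl t : {morph ltensor_act^~ t : b c / b + c}.
Proof.
move=> b c; move: t; apply: tensor_ext => [u v|u v|x y]; rewrite ?actD //.
  by rewrite addrACA.
by rewrite !ltensor_actE -tensDl; congr tens; exact: (@scalerDl _ (bim_left P)).
Qed.

Definition ltensor_mixin :=
  GRing.Zmodule_isLmodule.Build B PY actA act1 actD actDl.
Definition ltensor : lmodType B := HB.pack PY ltensor_mixin.
End TensorLeft.

Section TensorRight.
Variables (A C : pzRingType) (X : rmodType A) (Q : bimodule A C).
Notation XQ := (tensor X Q).

Let rbal (c : C) : balanced X Q XQ.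
Proof.
exists (fun x y => tens x (bract y c)) => [x x' y|x y y'|x a y].
- by rewrite -tensDl.
- by rewrite -tensDr -bractDl.
- by rewrite tensM bractZ.
Defined.

Definition rtensor_act (c : C^c) (t : XQ) : XQ := tensor_lift (rbal c) t.

Lemma rtensor_actE (c : C^c) x (y : Q) :
  rtensor_act c (tens x y) = tens x (bract y c).
Proof. exact: tensor_liftE. Qed.

Let actD c : {morph rtensor_act c : x y / x + y}.
Proof. exact: raddfD. Qed.

Let actA (b c : C^c) t :
  rtensor_act b (rtensor_act c t) = rtensor_act (b * c) t.
Proof.
move: t; apply: tensor_ext => [u v|u v|x y]; rewrite ?actD //.
by rewrite !rtensor_actE bractA.
Qed.
Let act1 : left_id 1 rtensor_act.
Proof.
by apply: tensor_ext => [u v|u v|x y]; rewrite ?actD ?rtensor_actE ?bract1.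
Qed.
Let actDl t : {morph rtensor_act^~ t : b c / b + c}.
Proof.
move=> b c; move: t; apply: tensor_ext => [u v|u v|x y]; rewrite ?actD //.
  by rewrite addrACA.
by rewrite !rtensor_actE -tensDr -bractDr.
Qed.

Definition rtensor_mixin :=
  GRing.Zmodule_isLmodule.Build C^c XQ actA act1 actD actDl.
Definition rtensor : rmodType C := HB.pack XQ rtensor_mixin.
End TensorRight.

Section TensorBimodule.
Variables (B A C : pzRingType) (P : bimodule B A) (Q : bimodule A C).

Let ract (t : ltensor P Q) (c : C) : ltensor P Q :=
  racts (t : rtensor (bim_right P) Q) c.

Let ractA t b c : ract (ract t b) c = ract t (b * c).
Proof. exact: (@ractsA _ (rtensor (bim_right P) Q)). Qed.
Let ract1 t : ract t 1 = t.
Proof. exact: (@racts1 _ (rtensor (bim_right P) Q)). Qed.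
Let ractDl t u b : ract (t + u) b = ract t b + ract u b.
Proof. exact: (@ractsDl _ (rtensor (bim_right P) Q)). Qed.
Let ractDr t b c : ract t (b + c) = ract t b + ract t c.
Proof. exact: (@ractsDr _ (rtensor (bim_right P) Q)). Qed.
Let ractZ b t c : ract (b *: t) c = b *: ract t c.
Proof.
move: t; apply: (@tensor_ext _ (bim_right P) Q (ltensor P Q)) => [u v|u v|x y].
- by rewrite scalerDr ractDl.
- by rewrite ractDl scalerDr.
rewrite -[RHS]/(ltensor_act b (rtensor_act (c : C^c) (tens x y))).
rewrite -[LHS]/(rtensor_act (c : C^c) (ltensor_act b (tens x y))).
by rewrite ltensor_actE !rtensor_actE ltensor_actE.
Qed.

Definition btensor : bimodule B C :=
  @Bimodule B C (ltensor P Q) ract ractA ract1 ractDl ractDr ractZ.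
End TensorBimodule.

Record equivalence_data (I J : pzRingType) (P : bimodule I J)
    (Q : bimodule J I)
    (alpha : btensor P Q -> regular_bimodule I)
    (beta : btensor Q P -> regular_bimodule J) : Prop := EquivalenceData {
  eqd_alpha : bimod_iso alpha;
  eqd_beta : bimod_iso beta;
  eqd_alpha_beta : forall (p p' : P) (q : Q),
    (alpha (tens (p : bim_right P) q) : I) *: p' =
    bract p (beta (tens (q : bim_right Q) p'));
  eqd_beta_alpha : forall (q q' : Q) (p : P),
    (beta (tens (q : bim_right Q) p) : J) *: q' =
    bract q (alpha (tens (p : bim_right P) q')) }.

Section SubZmod.
Variables (V : zmodType) (N : zmodClosed V).
Record subgroup := Subgroup { sub_val : V; sub_valP : sub_val \in N }.
HB.instance Definition _ := [isSub for sub_val].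
HB.instance Definition _ := [Choice of subgroup by <:].
HB.instance Definition _ := [SubChoice_isSubZmodule of subgroup by <:].
End SubZmod.

(* A subset of S that is a unital ring for the operations of S; its identity
   may differ from that of S, as for S_e and \epsilon_g R. *)
Record usubring (S : pzRingType) := Usubring {
  usub_set : zmodClosed S;
  usub_one : S;
  usub_one_in : usub_one \in usub_set;
  usub_mul_in : {in usub_set &, forall x y, x * y \in usub_set};
  usub_mul1l : {in usub_set, forall x, usub_one * x = x};
  usub_mul1r : {in usub_set, forall x, x * usub_one = x} }.

Section UsubringRing.
Variables (S : pzRingType) (U : usubring S).
Notation T := (subgroup (usub_set U)).
Let one : T := Subgroup (usub_one_in U).
Let mul (x y : T) : T := Subgroup (usub_mul_in (sub_valP x) (sub_valP y)).
Let mulA : associative mul.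
Proof. by move=> x y z; apply: val_inj; apply: mulrA. Qed.
Let mul1l : left_id one mul.
Proof. by move=> x; apply: val_inj; apply: usub_mul1l (sub_valP x). Qed.
Let mul1r : right_id one mul.
Proof. by move=> x; apply: val_inj; apply: usub_mul1r (sub_valP x). Qed.
Let mulDl : left_distributive mul +%R.
Proof. by move=> x y z; apply: val_inj; apply: mulrDl. Qed.
Let mulDr : right_distributive mul +%R.
Proof. by move=> x y z; apply: val_inj; apply: mulrDr. Qed.
Definition usub_mixin :=
  GRing.Zmodule_isPzRing.Build T mulA mul1l mul1r mulDl mulDr.
Definition usub_ring : pzRingType := HB.pack T usub_mixin.
End UsubringRing.
Coercion usub_ring : usubring >-> GRing.PzRing.type.

Section SubModules.
Variables (S : pzRingType).

Section Left.
Variables (U : usubring S) (M : lmodType S) (N : zmodClosed M).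
Hypothesis clos : forall a x, a \in usub_set U -> x \in N -> a *: x \in N.
Hypothesis unit : forall x, x \in N -> usub_one U *: x = x.
Notation T := (subgroup N).
Let act (a : U) (x : T) : T := Subgroup (clos (sub_valP a) (sub_valP x)).
Let actA a b x : act a (act b x) = act (a * b) x.
Proof. by apply: val_inj; apply: scalerA. Qed.
Let act1 : left_id 1 act.
Proof. by move=> x; apply: val_inj; apply: unit (sub_valP x). Qed.
Let actDr : right_distributive act +%R.
Proof. by move=> a x y; apply: val_inj; apply: scalerDr. Qed.
Let actDl x : {morph act^~ x : a b / a + b}.
Proof. by move=> a b; apply: val_inj; apply: scalerDl. Qed.
Definition sub_lmod_mixin :=
  GRing.Zmodule_isLmodule.Build U T actA act1 actDr actDl.
Definition sub_lmod : lmodType U := HB.pack T sub_lmod_mixin.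
End Left.

Section Right.
Variables (U : usubring S) (M : rmodType S) (N : zmodClosed M).
Hypothesis clos : forall x a, x \in N -> a \in usub_set U -> x *:r a \in N.
Hypothesis unit : forall x, x \in N -> x *:r usub_one U = x.
Notation T := (subgroup N).
Let act (a : U^c) (x : T) : T :=
  Subgroup (clos (sub_valP x) (sub_valP (a : U))).
Let actA a b x : act a (act b x) = act (a * b) x.
Proof. by apply: val_inj; apply: ractsA. Qed.
Let act1 : left_id 1 act.
Proof. by move=> x; apply: val_inj; apply: unit (sub_valP x). Qed.
Let actDr : right_distributive act +%R.
Proof. by move=> a x y; apply: val_inj; apply: ractsDl. Qed.
Let actDl x : {morph act^~ x : a b / a + b}.
Proof. by move=> a b; apply: val_inj; apply: ractsDr. Qed.
Definition sub_rmod_mixin :=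
  GRing.Zmodule_isLmodule.Build U^c T actA act1 actDr actDl.
Definition sub_rmod : rmodType U := HB.pack T sub_rmod_mixin.
End Right.

Section Bimod.
Variables (U V : usubring S) (N : zmodClosed S).
Hypothesis lclos : forall a x, a \in usub_set U -> x \in N -> a * x \in N.
Hypothesis lunit : forall x, x \in N -> usub_one U * x = x.
Hypothesis rclos : forall x b, x \in N -> b \in usub_set V -> x * b \in N.
Hypothesis runit : forall x, x \in N -> x * usub_one V = x.
Let L : lmodType U := @sub_lmod U S^o N lclos lunit.
Let act (x : L) (b : V) : L :=
  Subgroup (rclos (sub_valP (x : subgroup N)) (sub_valP b)).
Let actA x b c : act (act x b) c = act x (b * c).
Proof. by apply: val_inj; apply: (esym (mulrA _ _ _)). Qed.
Let act1 x : act x 1 = x.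
Proof. by apply: val_inj; apply: runit (sub_valP (x : subgroup N)). Qed.
Let actDl x y b : act (x + y) b = act x b + act y b.
Proof. by apply: val_inj; apply: mulrDl. Qed.
Let actDr x b c : act x (b + c) = act x b + act x c.
Proof. by apply: val_inj; apply: mulrDr. Qed.
Let actZ a x b : act (a *: x) b = a *: act x b.
Proof. by apply: val_inj; apply: (esym (mulrA _ _ _)). Qed.
Definition sub_bimod : bimodule U V :=
  @Bimodule U V L act actA act1 actDl actDr actZ.
End Bimod.
End SubModules.

Section ImageSubgroup.
Variables (V : zmodType) (f : {additive V -> V}) (N : zmodClosed V).
Definition image_set : {pred V} := fun y => `[< exists2 x, x \in N & y = f x >].
Fact image_set_zmod : zmod_closed image_set.
Proof.
split; first by apply/asboolP; exists 0; rewrite ?rpred0 ?raddf0.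
move=> u v /asboolP [x xN ->] /asboolP [y yN ->]; apply/asboolP.
by exists (x - y); rewrite ?rpredB ?raddfB.
Qed.
HB.instance Definition _ := GRing.isZmodClosed.Build V image_set image_set_zmod.
Definition image_sub : zmodClosed V := image_set.
End ImageSubgroup.

(* a N in a left module, N a in a right module, and a N, N a in a ring. *)
Definition lscales (A : pzRingType) (M : lmodType A) (a : A)
  (N : zmodClosed M) : zmodClosed M := image_sub ( *:%R a) N.
Definition rscales (A : pzRingType) (M : rmodType A) (N : zmodClosed M)
  (a : A) : zmodClosed M := image_sub ( *:%R (a : A^c)) N.
Definition lmuls (A : pzRingType) (a : A) (N : zmodClosed A) : zmodClosed A :=
  image_sub (a \*o idfun) N.
Definition rmuls (A : pzRingType) (N : zmodClosed A) (a : A) : zmodClosed A :=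
  image_sub (a \o* idfun) N.

Section SetProducts.
Variable S : pzRingType.
Implicit Types A B : {pred S}.

Definition mulset A B : {pred S} := fun x =>
  `[< exists2 s : seq (S * S), (forall p, p \in s -> p.1 \in A /\ p.2 \in B) &
        x = \sum_(p <- s) p.1 * p.2 >].

Definition identity_of A (u : S) :=
  u \in A /\ {in A, forall x, u * x = x /\ x * u = x}.

Record unital_ideal B A : Prop := UnitalIdeal {
  uideal_zmod : zmod_closed A;
  uideal_sub : {subset A <= B};
  uideal_mull : {in B & A, forall b x, b * x \in A};
  uideal_mulr : {in A & B, forall x b, x * b \in A};
  uideal_one : exists u, identity_of A u }.

Lemma mulset_ind A B (Q : S -> Prop) :
  Q 0 -> (forall x y, Q x -> Q y -> Q (x + y)) ->
  {in A & B, forall a b, Q (a * b)} -> {in mulset A B, forall x, Q x}.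
Proof.
move=> Q0 QD Qm x /asboolP [s sP ->].
elim: s sP => [|p s IH] sP; first by rewrite big_nil.
rewrite big_cons; apply: QD; last first.
  by apply: IH => q qs; apply: sP; rewrite inE qs orbT.
by have [pA pB] := sP p (mem_head _ _); apply: Qm.
Qed.

Lemma mulset_mul A B a b : a \in A -> b \in B -> a * b \in mulset A B.
Proof.
move=> aA bB; apply/asboolP; exists [:: (a, b)]; last by rewrite big_seq1.
by move=> p; rewrite inE => /eqP ->.
Qed.
End SetProducts.

(* A small groupoid.  [gcomp g h] is the composite g h and is meaningful only
   when [gdom g = gcod h]; its other values are unconstrained.  Objects are
   embedded in the morphisms by [gid]. *)
Record groupoid := Groupoid {
  obj : Type;
  mor :> choiceType;
  gdom : mor -> obj;
  gcod : mor -> obj;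
  gid : obj -> mor;
  gcomp : mor -> mor -> mor;
  ginv : mor -> mor;
  gdom_id : forall e, gdom (gid e) = e;
  gcod_id : forall e, gcod (gid e) = e;
  gdom_comp : forall g h, gdom g = gcod h -> gdom (gcomp g h) = gdom h;
  gcod_comp : forall g h, gdom g = gcod h -> gcod (gcomp g h) = gcod g;
  gcompA : forall g h k, gdom g = gcod h -> gdom h = gcod k ->
    gcomp g (gcomp h k) = gcomp (gcomp g h) k;
  gcomp1l : forall g, gcomp (gid (gcod g)) g = g;
  gcomp1r : forall g, gcomp g (gid (gdom g)) = g;
  gdom_inv : forall g, gdom (ginv g) = gcod g;
  gcod_inv : forall g, gcod (ginv g) = gdom g;
  gcompV : forall g, gcomp g (ginv g) = gid (gcod g);
  gcompVl : forall g, gcomp (ginv g) g = gid (gdom g) }.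

Section GroupoidTheory.
Variable G : groupoid.
Implicit Types g h k : G.

Lemma ginvK g : ginv (ginv g) = g.
Proof.
have d : gdom (ginv (ginv g)) = gcod (ginv g) by rewrite gdom_inv.
rewrite -[LHS]gcomp1r d gcod_inv -gcompVl gcompA ?gdom_inv //.
by rewrite gcompVl gdom_inv gcomp1l.
Qed.

Lemma gcomp_cancelr g h k : gdom g = gcod k -> gdom h = gcod k ->
  gcomp g k = gcomp h k -> g = h.
Proof.
move=> gk hk /(congr1 (fun x : G => gcomp x (ginv k))) /=.
by rewrite -!gcompA ?gcod_inv // gcompV -{1}gk -hk !gcomp1r.
Qed.
End GroupoidTheory.

(* V is the internal direct sum of the subgroups A i. *)
Definition direct_sum (I : choiceType) (V : zmodType) (A : I -> zmodClosed V) :=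
  (forall x, exists (s : seq I) (f : I -> V),
     [/\ uniq s, forall i, f i \in A i & x = \sum_(i <- s) f i]) /\
  (forall (s : seq I) (f : I -> V), uniq s -> (forall i, f i \in A i) ->
     \sum_(i <- s) f i = 0 -> forall i, i \in s -> f i = 0).

Section DirectSum.
Variables (I : choiceType) (V : zmodType) (A : I -> zmodClosed V).
Hypothesis dA : direct_sum A.

Let trunc (s : seq I) (f : I -> V) i := if i \in s then f i else 0.

Let sum_trunc s w f : uniq s -> uniq w -> {subset s <= w} ->
  \sum_(i <- w) trunc s f i = \sum_(i <- s) f i.
Proof.
move=> us uw sw; rewrite -big_mkcond -big_filter; apply: perm_big.
apply: uniq_perm => //; first exact: filter_uniq.
by move=> i; rewrite mem_filter; case: (boolP (i \in s)) => // /sw ->.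
Qed.

Let truncP s f : (forall i, f i \in A i) -> forall i, trunc s f i \in A i.
Proof. by move=> fA i; rewrite /trunc; case: ifP; rewrite ?rpred0. Qed.

Let trunc_uniq s t f g : uniq s -> uniq t ->
  (forall i, f i \in A i) -> (forall i, g i \in A i) ->
  \sum_(i <- s) f i = \sum_(i <- t) g i -> trunc s f =1 trunc t g.
Proof.
move=> us ut fA gA E i; pose w := undup (s ++ t).
have uw : uniq w by rewrite undup_uniq.
have sw : {subset s <= w} by move=> j js; rewrite mem_undup mem_cat js.
have tw : {subset t <= w} by move=> j jt; rewrite mem_undup mem_cat jt orbT.
have H := dA.2 w (fun j => trunc s f j - trunc t g j) uw.
have [iw|iw] := boolP (i \in w).
  apply/eqP; rewrite -subr_eq0; apply/eqP; apply: H iw => //.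
    by move=> j; rewrite rpredB ?truncP.
  by rewrite sumrB !sum_trunc // E subrr.
by rewrite /trunc !ifN //; apply: contra iw => ?; [apply: tw | apply: sw].
Qed.

Lemma direct_sum_proj : exists p : I -> V -> V,
  [/\ forall i x y, p i (x + y) = p i x + p i y,
      forall i x, x \in A i -> p i x = x
    & forall i j x, i != j -> x \in A j -> p i x = 0].
Proof.
have /choice [sf sfP] : forall x, exists sf : seq I * (I -> V),
    [/\ uniq sf.1, forall i, sf.2 i \in A i & x = \sum_(i <- sf.1) sf.2 i].
  by move=> x; have [s [f H]] := dA.1 x; exists (s, f).
pose p i x := trunc (sf x).1 (sf x).2 i.
have pE i x s f : uniq s -> (forall j, f j \in A j) ->
    x = \sum_(j <- s) f j -> p i x = trunc s f i.
  move=> us fA xE; have [uS fS xS] := sfP x.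
  by apply: trunc_uniq => //; rewrite -xS.
have pA i j x : x \in A j -> p i x = if i == j then x else 0.
  move=> xA.
  rewrite (pE i x [:: j] (fun k => if k == j then x else 0)) //; first last.
  - by rewrite big_seq1 eqxx.
  - by move=> k; case: eqP => [->|]; rewrite ?rpred0.
  by rewrite /trunc inE; case: eqP.
exists p; split=> [i x y|i x xA|i j x ij xA]; first last.
- by rewrite (pA i j) // (negPf ij).
- by rewrite (pA i i) // eqxx.
have [us fs xE] := sfP x; have [ut ft yE] := sfP y.
pose w := undup ((sf x).1 ++ (sf y).1).
have uw : uniq w by rewrite undup_uniq.
have sw : {subset (sf x).1 <= w} by move=> j js; rewrite mem_undup mem_cat js.
have tw : {subset (sf y).1 <= w}.
  by move=> j jt; rewrite mem_undup mem_cat jt orbT.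
rewrite (pE i _ w (fun j => p j x + p j y)) //.
- rewrite {1}/trunc; case: ifP => // /negbT iw.
  rewrite /p /trunc !ifN ?addr0 //; apply: contra iw => ?.
    exact: tw.
  exact: sw.
- by move=> j; rewrite rpredD ?truncP.
by rewrite big_split /= !sum_trunc // -xE -yE.
Qed.
End DirectSum.

Section Grading.
Variables (G : groupoid) (S : pzRingType) (S_ : G -> zmodClosed S).
Implicit Types g h : G.

Definition graded_ring : Prop := direct_sum S_ /\
  forall g h, {in S_ g & S_ h, forall x y,
    (gdom g = gcod h -> x * y \in S_ (gcomp g h)) /\
    (gdom g <> gcod h -> x * y = 0)}.

Definition epsilon_strong : Prop :=
  (forall g, unital_ideal (S_ (gid (gcod g))) (mulset (S_ g) (S_ (ginv g)))) /\
  (forall g h, gdom g = gcod h ->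
     mulset (S_ g) (S_ h)
       =i mulset (mulset (S_ g) (S_ (ginv g))) (S_ (gcomp g h)) /\
     mulset (S_ g) (S_ h)
       =i mulset (mulset (S_ (gcomp g h)) (S_ (ginv h))) (S_ h)).

Definition graded_lmod (M : lmodType S) (M_ : G -> zmodClosed M) : Prop :=
  direct_sum M_ /\
  forall g h, {in S_ g & M_ h, forall s m,
    (gdom g = gcod h -> s *: m \in M_ (gcomp g h)) /\
    (gdom g <> gcod h -> s *: m = 0)}.

Definition graded_rmod (M : rmodType S) (M_ : G -> zmodClosed M) : Prop :=
  direct_sum M_ /\
  forall g h, {in M_ g & S_ h, forall m s,
    (gdom g = gcod h -> m *:r s \in M_ (gcomp g h)) /\
    (gdom g <> gcod h -> m *:r s = 0)}.

(* R: the finite sums of elements of the S_e, e an object; the sum of the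
   subgroups S_e is direct as soon as S is graded. *)
Definition base_set : {pred S} := fun x =>
  `[< exists2 s : seq S, (forall y, y \in s -> exists e, y \in S_ (gid e)) &
        x = \sum_(y <- s) y >].

Lemma base_set_ind (Q : S -> Prop) :
  Q 0 -> (forall x y, Q x -> Q y -> Q (x + y)) ->
  (forall e x, x \in S_ (gid e) -> Q x) -> {in base_set, forall x, Q x}.
Proof.
move=> Q0 QD Qe x /asboolP [s sP ->].
elim: s sP => [|y s IH] sP; first by rewrite big_nil.
rewrite big_cons; apply: QD; last first.
  by apply: IH => z zs; apply: sP; rewrite inE zs orbT.
by have [e] := sP y (mem_head _ _); apply: Qe.
Qed.

Fact base_set_zmod : zmod_closed base_set.
Proof.
split; first by apply/asboolP; exists [::]; rewrite ?big_nil.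
move=> x y /asboolP [s sP ->] /asboolP [t tP ->]; apply/asboolP.
exists (s ++ [seq - z | z <- t]).
  move=> z; rewrite mem_cat => /orP [/sP //|/mapP [u /tP [e ue] ->]].
  by exists e; rewrite rpredN.
by rewrite big_cat big_map sumrN.
Qed.
HB.instance Definition _ := GRing.isZmodClosed.Build S base_set base_set_zmod.
Definition base_sub : zmodClosed S := base_set.

Lemma comp_base e x : x \in S_ (gid e) -> x \in base_sub.
Proof.
move=> xe; apply/asboolP; exists [:: x]; last by rewrite big_seq1.
by move=> y; rewrite inE => /eqP ->; exists e.
Qed.

Section GradedTheory.
Hypothesis grS : graded_ring.

Lemma gradedM g h x y : gdom g = gcod h -> x \in S_ g -> y \in S_ h ->
  x * y \in S_ (gcomp g h).
Proof. by move=> gh xg yh; apply: (grS.2 g h x y xg yh).1. Qed.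

Lemma graded0 g h x y : gdom g <> gcod h -> x \in S_ g -> y \in S_ h ->
  x * y = 0.
Proof. by move=> gh xg yh; apply: (grS.2 g h x y xg yh).2. Qed.

Lemma comp_base_l e h r x : r \in S_ (gid e) -> x \in S_ h -> r * x \in S_ h.
Proof.
move=> re xh; have [eh|eh] := pselect (gdom (gid e) = gcod h).
  move: (gradedM eh re xh); rewrite gdom_id in eh.
  by rewrite eh gcomp1l.
by rewrite (graded0 eh re xh) rpred0.
Qed.

Lemma comp_base_r e h r x : r \in S_ (gid e) -> x \in S_ h -> x * r \in S_ h.
Proof.
move=> re xh; have [eh|eh] := pselect (gdom h = gcod (gid e)).
  move: (gradedM eh xh re); rewrite gcod_id in eh.
  by rewrite -eh gcomp1r.
by rewrite (graded0 eh xh re) rpred0.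
Qed.

Lemma base_l h r x : r \in base_sub -> x \in S_ h -> r * x \in S_ h.
Proof.
move=> rR xh; move: r rR; apply: base_set_ind => [|r t rh th|e r re].
- by rewrite mul0r rpred0.
- by rewrite mulrDl rpredD.
exact: comp_base_l re xh.
Qed.

Lemma base_r h x r : x \in S_ h -> r \in base_sub -> x * r \in S_ h.
Proof.
move=> xh; move: r; apply: base_set_ind => [|r t rh th|e r re].
- by rewrite mulr0 rpred0.
- by rewrite mulrDr rpredD.
exact: comp_base_r re xh.
Qed.

Lemma base_mul : {in base_sub &, forall x y, x * y \in base_sub}.
Proof.
move=> x y xR yR; move: y yR; apply: base_set_ind => [|y z yR zR|e y ye].
- by rewrite mulr0 rpred0.
- by rewrite mulrDr rpredD.
by apply: (@comp_base e); apply: base_l.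
Qed.

(* The components of 1_S in the degrees e are the identities of the S_e. *)
Lemma unit_exists : exists u : obj G -> S,
  [/\ forall e, u e \in S_ (gid e),
      exists s : seq (obj G), 1 = \sum_(e <- s) u e,
      forall h x, x \in S_ h -> u (gcod h) * x = x
    & forall h x, x \in S_ h -> x * u (gdom h) = x].
Proof.
have [s [f [us fS one]]] := grS.1.1 1.
have [p [pD pid p0]] := direct_sum_proj grS.1.
have pz i : p i 0 = 0 by apply: (addrI (p i 0)); rewrite -pD !addr0.
have psum i (r : seq G) (F : G -> S) :
    p i (\sum_(k <- r) F k) = \sum_(k <- r) p i (F k).
  by apply: (big_morph (p i)) => [x y|]; rewrite ?pD ?pz.
pose F g := if g \in s then f g else 0.
have FS g : F g \in S_ g by rewrite /F; case: ifP; rewrite ?rpred0.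
have oneF : 1 = \sum_(g <- s) F g.
  by rewrite one; apply: eq_big_seq => g gs; rewrite /F gs.
have pF h x g : x \in S_ h -> gdom g = gcod h -> p (gcomp g h) x = F g * x.
  move=> xh gh; rewrite -{1}[x]mul1r oneF mulr_suml psum.
  have other k : k != g -> p (gcomp g h) (F k * x) = 0.
    move=> kg; have [kh|kh] := pselect (gdom k = gcod h); last first.
      by rewrite (graded0 kh (FS k) xh) pz.
    apply: p0 (gradedM kh (FS k) xh); apply: contra kg => /eqP E.
    by apply/eqP/esym; apply: (gcomp_cancelr gh kh E).
  have [gs|gs] := boolP (g \in s).
    rewrite (bigD1_seq g) //= big1 ?addr0 => [|k kg]; last exact: other.
    by apply: pid; apply: gradedM.
  rewrite {2}/F (negPf gs) mul0r big_seq big1 // => k ks; apply: other.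
  by apply: contraNneq gs => <-.
have F1 h x : x \in S_ h -> F (gid (gcod h)) * x = x.
  move=> xh; have e : gdom (gid (gcod h)) = gcod h by rewrite gdom_id.
  by rewrite -(pF h x _ xh e) gcomp1l pid.
have F0 g : g <> gid (gcod g) -> F g = 0.
  move=> gN; rewrite -[F g]mulr1 oneF mulr_sumr big1 // => h _.
  have [gh|gh] := pselect (gdom g = gcod h); last exact: graded0 gh _ _.
  rewrite -(pF h _ g (FS h) gh); apply: p0 (FS h); apply/eqP => E.
  apply: gN.
  have E' : gcomp g h = gcomp (gid (gcod h)) h by rewrite gcomp1l.
  have gid_g := gcomp_cancelr gh (gdom_id _) E'.
  by rewrite {1}gid_g gid_g gcod_id.
exists (fun e => F (gid e)); split=> //.
- exists [seq gcod g | g <- s & `[< g = gid (gcod g) >]].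
  rewrite big_map big_filter oneF.
  rewrite (bigID (fun g => `[< g = gid (gcod g) >])) /= addrC big1 ?add0r.
    by apply: eq_bigr => g /asboolP <-.
  by move=> g /asboolPn /F0.
move=> h x xh.
rewrite -{2}[x]mulr1 oneF mulr_sumr.
have other k : k <> gid (gdom h) -> x * F k = 0.
  move=> kh; have [kE|kN] := pselect (k = gid (gcod k)); last first.
    by rewrite F0 // mulr0.
  apply: graded0 xh (FS k) => E; apply: kh.
  by rewrite kE E.
have [hs|hs] := boolP (gid (gdom h) \in s).
  by rewrite (bigD1_seq (gid (gdom h))) //= big1 ?addr0 // => k /eqP /other.
rewrite {1}/F (negPf hs) mulr0 big_seq big1 // => k ks; apply: other => E.
by rewrite E (negPf hs) in ks.
Qed.

Definition comp_one : obj G -> S := sval (cid unit_exists).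

Lemma comp_one_in e : comp_one e \in S_ (gid e).
Proof. by rewrite /comp_one; case: cid => u [] /=. Qed.
Lemma comp_one_sum : exists s : seq (obj G), 1 = \sum_(e <- s) comp_one e.
Proof. by rewrite /comp_one; case: cid => u [] /=. Qed.
Lemma comp_one_l h x : x \in S_ h -> comp_one (gcod h) * x = x.
Proof. by rewrite /comp_one; case: cid => u [] /= _ _ H _; apply: H. Qed.
Lemma comp_one_r h x : x \in S_ h -> x * comp_one (gdom h) = x.
Proof. by rewrite /comp_one; case: cid => u [] /= _ _ _ H; apply: H. Qed.

Lemma base_one : 1 \in base_sub.
Proof.
have [s ->] := comp_one_sum; apply: rpred_sum => e _.
exact: comp_base (comp_one_in e).
Qed.

Definition base_ring : usubring S :=
  @Usubring S base_sub 1 base_one base_mul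
    (fun x _ => mul1r x) (fun x _ => mulr1 x).

Fact comp_ring_mul e : {in S_ (gid e) &, forall x y, x * y \in S_ (gid e)}.
Proof. by move=> x y xe ye; apply: comp_base_l xe ye. Qed.
Fact comp_ring_1l e : {in S_ (gid e), forall x, comp_one e * x = x}.
Proof. by move=> x /comp_one_l; rewrite gcod_id. Qed.
Fact comp_ring_1r e : {in S_ (gid e), forall x, x * comp_one e = x}.
Proof. by move=> x /comp_one_r; rewrite gdom_id. Qed.

(* The ring S_e, whose identity is the component of 1_S in degree e. *)
Definition comp_ring (e : obj G) : usubring S :=
  @Usubring S (S_ (gid e)) (comp_one e) (comp_one_in e)
    (@comp_ring_mul e) (@comp_ring_1l e) (@comp_ring_1r e).

Section LeftModules.
Variables (M : lmodType S) (M_ : G -> zmodClosed M).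
Hypothesis grM : graded_lmod M_.

Lemma graded_lmodM g h s m : gdom g = gcod h -> s \in S_ g -> m \in M_ h ->
  s *: m \in M_ (gcomp g h).
Proof. by move=> gh sg mh; apply: (grM.2 g h s m sg mh).1. Qed.

Lemma graded_lmod0 g h s m : gdom g <> gcod h -> s \in S_ g -> m \in M_ h ->
  s *: m = 0.
Proof. by move=> gh sg mh; apply: (grM.2 g h s m sg mh).2. Qed.

Lemma lmod_comp_l e h r m : r \in S_ (gid e) -> m \in M_ h -> r *: m \in M_ h.
Proof.
move=> re mh; have [eh|eh] := pselect (gdom (gid e) = gcod h).
  by move: (graded_lmodM eh re mh); rewrite gdom_id in eh; rewrite eh gcomp1l.
by rewrite (graded_lmod0 eh re mh) rpred0.
Qed.

Lemma lmod_base_l h r m : r \in base_sub -> m \in M_ h -> r *: m \in M_ h.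
Proof.
move=> rR mh; move: r rR; apply: base_set_ind => [|r t rh th|e r re].
- by rewrite scale0r rpred0.
- by rewrite scalerDl rpredD.
exact: lmod_comp_l re mh.
Qed.

Lemma lmod_comp_one h m : m \in M_ h -> comp_one (gcod h) *: m = m.
Proof.
move=> mh; rewrite -{2}[m]scale1r; have [s one] := comp_one_sum.
have : comp_one (gcod h) * 1 = comp_one (gcod h) by rewrite mulr1.
rewrite {1}one mulr_sumr => <-; rewrite one !scaler_suml.
apply: eq_bigr => e _; have [eh|eh] := pselect (gcod h = e).
  by rewrite -eh comp_ring_1l ?comp_one_in.
rewrite (graded0 _ (comp_one_in _) (comp_one_in _)) ?gdom_id ?gcod_id //.
rewrite scale0r (graded_lmod0 _ (comp_one_in e) mh) // gdom_id.
by move=> E; apply: eh.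
Qed.

(* M_h is a left S_e-module for e = c(h). *)
Fact comp_lmod_clos h e (eh : e = gcod h) a x :
  a \in usub_set (comp_ring e) -> x \in M_ h -> a *: x \in M_ h.
Proof. by move=> ae xh; apply: lmod_comp_l ae xh. Qed.
Fact comp_lmod_unit h e (eh : e = gcod h) x :
  x \in M_ h -> usub_one (comp_ring e) *: x = x.
Proof. by rewrite eh; apply: lmod_comp_one. Qed.
Definition comp_lmod h e (eh : e = gcod h) : lmodType (comp_ring e) :=
  sub_lmod (comp_lmod_clos eh) (comp_lmod_unit eh).
End LeftModules.

Section RightGradedModules.
Variables (M : rmodType S) (M_ : G -> zmodClosed M).
Hypothesis grM : graded_rmod M_.

Lemma graded_rmodM g h m s : gdom g = gcod h -> m \in M_ g -> s \in S_ h ->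
  m *:r s \in M_ (gcomp g h).
Proof. by move=> gh mg sh; apply: (grM.2 g h m s mg sh).1. Qed.

Lemma graded_rmod0 g h m s : gdom g <> gcod h -> m \in M_ g -> s \in S_ h ->
  m *:r s = 0.
Proof. by move=> gh mg sh; apply: (grM.2 g h m s mg sh).2. Qed.

Lemma rmod_comp_r e g r m : r \in S_ (gid e) -> m \in M_ g -> m *:r r \in M_ g.
Proof.
move=> re mg; have [eg|eg] := pselect (gdom g = gcod (gid e)).
  by move: (graded_rmodM eg mg re); rewrite gcod_id in eg; rewrite -eg gcomp1r.
by rewrite (graded_rmod0 eg mg re) rpred0.
Qed.

Lemma rmod_base_r g m r : m \in M_ g -> r \in base_sub -> m *:r r \in M_ g.
Proof.
move=> mg; move: r; apply: base_set_ind => [|r t rh th|e r re].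
- by rewrite /racts scale0r rpred0.
- by rewrite ractsDr rpredD.
exact: rmod_comp_r re mg.
Qed.

Lemma rmod_comp_one g m : m \in M_ g -> m *:r comp_one (gdom g) = m.
Proof.
move=> mg; rewrite -{2}[m]racts1; have [s one] := comp_one_sum.
have : 1 * comp_one (gdom g) = comp_one (gdom g) by rewrite mul1r.
rewrite {1}one mulr_suml => <-; rewrite one /racts.
rewrite (@scaler_suml S^c) (@scaler_suml S^c).
apply: eq_bigr => e _; have [eg|eg] := pselect (gdom g = e).
  by rewrite -eg comp_ring_1l ?comp_one_in.
rewrite (graded0 _ (comp_one_in _) (comp_one_in _)) ?gdom_id ?gcod_id //;
  last by move=> E; apply: eg.
rewrite scale0r -[RHS]/(m *:r _) (graded_rmod0 _ mg (comp_one_in e)) //.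
by rewrite gcod_id.
Qed.

(* M_g is a right S_e-module for e = d(g). *)
Fact comp_rmod_clos g e (eg : gdom g = e) x a :
  x \in M_ g -> a \in usub_set (comp_ring e) -> x *:r a \in M_ g.
Proof. by move=> xg ae; apply: rmod_comp_r ae xg. Qed.
Fact comp_rmod_unit g e (eg : gdom g = e) x :
  x \in M_ g -> x *:r usub_one (comp_ring e) = x.
Proof. by rewrite -eg; apply: rmod_comp_one. Qed.
Definition comp_rmod g e (eg : gdom g = e) : rmodType (comp_ring e) :=
  sub_rmod (comp_rmod_clos eg) (comp_rmod_unit eg).
End RightGradedModules.

(* S_g as an R-S_e-bimodule for e = d(g), as an S_e-R-bimodule for e = c(g),
   and as an R-bimodule. *)
Fact base_r_comp g e x b :
  x \in S_ g -> b \in usub_set (comp_ring e) -> x * b \in S_ g.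
Proof. by move=> xg be; apply: comp_base_r be xg. Qed.
Fact base_l_comp g e b x :
  b \in usub_set (comp_ring e) -> x \in S_ g -> b * x \in S_ g.
Proof. by move=> be xg; apply: comp_base_l be xg. Qed.
Fact comp_runit g e (ge : gdom g = e) x :
  x \in S_ g -> x * usub_one (comp_ring e) = x.
Proof. by rewrite -ge; apply: comp_one_r. Qed.
Fact comp_lunit g e (eg : e = gcod g) x :
  x \in S_ g -> usub_one (comp_ring e) * x = x.
Proof. by rewrite eg; apply: comp_one_l. Qed.

Definition comp_bimod_base_comp g e (ge : gdom g = e) :
    bimodule base_ring (comp_ring e) :=
  @sub_bimod S base_ring (comp_ring e) (S_ g) (@base_l g) (fun x _ => mul1r x)
    (@base_r_comp g e) (comp_runit ge).

Definition comp_bimod_comp_base g e (eg : e = gcod g) :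
    bimodule (comp_ring e) base_ring :=
  @sub_bimod S (comp_ring e) base_ring (S_ g) (@base_l_comp g e)
    (comp_lunit eg) (@base_r g) (fun x _ => mulr1 x).

Definition comp_bimod g : bimodule base_ring base_ring :=
  @sub_bimod S base_ring base_ring (S_ g) (@base_l g) (fun x _ => mul1r x)
    (@base_r g) (fun x _ => mulr1 x).
End GradedTheory.
End Grading.

Section EpsilonStrong.
Variables (G : groupoid) (S : pzRingType) (S_ : G -> zmodClosed S).
Hypothesis grS : graded_ring S_.
Hypothesis esS : epsilon_strong S_.
Variable eps : G -> S.
Hypothesis epsP : forall g, identity_of (mulset (S_ g) (S_ (ginv g))) (eps g).
Implicit Types g h : G.

Local Notation R := (base_ring grS).

Lemma eps_comp g : eps g \in S_ (gid (gcod g)).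
Proof. exact: (uideal_sub (esS.1 g) (epsP g).1). Qed.

Lemma eps_base g : eps g \in base_sub S_.
Proof. exact: comp_base (eps_comp g). Qed.

Lemma eps_idem g : eps g * eps g = eps g.
Proof. exact: ((epsP g).2 _ (epsP g).1).1. Qed.

Lemma eps_central g r : r \in base_sub S_ -> eps g * r = r * eps g.
Proof.
move: r; apply: base_set_ind => [|r t rg tg|e r re].
- by rewrite mulr0 mul0r.
- by rewrite mulrDr mulrDl rg tg.
have [eg|eg] := pselect (e = gcod g).
  rewrite eg in re; have [_ _ Il Ir _] := esS.1 g; have [gI gP] := epsP g.
  by rewrite -(gP _ (Ir _ _ gI re)).2 -mulrA (gP _ (Il _ _ re gI)).1.
rewrite (graded0 grS _ (eps_comp g) re) ?(graded0 grS _ re (eps_comp g)) //.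
  by rewrite gdom_id gcod_id.
by rewrite gdom_id gcod_id => E; apply: eg.
Qed.

Lemma eps_l g s : s \in S_ g -> eps g * s = s.
Proof.
move=> sg; have gd : gdom g = gcod (gid (gdom g)) by rewrite gcod_id.
have := mulset_mul sg (comp_one_in grS (gdom g)).
rewrite comp_one_r // (esS.2 _ _ gd).1 gcomp1r.
move: s {sg}; apply: mulset_ind => [|x y xE yE|a b aI _].
- by rewrite mulr0.
- by rewrite mulrDr xE yE.
by rewrite mulrA ((epsP g).2 _ aI).1.
Qed.

Lemma eps_r h s : s \in S_ h -> s * eps (ginv h) = s.
Proof.
move=> sh; have gd : gdom (gid (gcod h)) = gcod h by rewrite gdom_id.
have := mulset_mul (comp_one_in grS (gcod h)) sh.
rewrite comp_one_l // (esS.2 _ _ gd).2 gcomp1l.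
move: s {sh}; apply: mulset_ind => [|x y xE yE|a b aI bh].
- by rewrite mul0r.
- by rewrite mulrDl xE yE.
have [_ epsI] := epsP (ginv h); rewrite ginvK in epsI.
move: a aI; apply: mulset_ind => [|x y xE yE|a c ah ch].
- by rewrite !mul0r.
- by rewrite !mulrDl xE yE.
by rewrite -!mulrA (mulrA c) (epsI _ (mulset_mul ch bh)).2.
Qed.

(* The ring \epsilon_g R, with identity \epsilon_g. *)
Fact eps_ring_one g : eps g \in lmuls (eps g) (base_sub S_).
Proof. by apply/asboolP; exists 1; rewrite ?base_one //= mulr1. Qed.
Fact eps_ringP g x :
  x \in lmuls (eps g) (base_sub S_) -> x \in base_sub S_ /\ eps g * x = x.
Proof.
move=> /asboolP [r rR /= ->].
by rewrite mulrA eps_idem (base_mul grS (eps_base g)).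
Qed.
Fact eps_ring_in g x :
  x \in base_sub S_ -> eps g * x = x -> x \in lmuls (eps g) (base_sub S_).
Proof. by move=> xR xE; apply/asboolP; exists x. Qed.
Fact eps_ring_mul g :
  {in lmuls (eps g) (base_sub S_) &, forall x y,
    x * y \in lmuls (eps g) (base_sub S_)}.
Proof.
move=> x y /eps_ringP [xR xE] /eps_ringP [yR _].
by apply: eps_ring_in; [apply: base_mul | rewrite mulrA xE].
Qed.
Fact eps_ring_1l g : {in lmuls (eps g) (base_sub S_), forall x, eps g * x = x}.
Proof. by move=> x /eps_ringP []. Qed.
Fact eps_ring_1r g : {in lmuls (eps g) (base_sub S_), forall x, x * eps g = x}.
Proof. by move=> x /eps_ringP [xR xE]; rewrite -eps_central. Qed.

Definition eps_ring g : usubring S :=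
  @Usubring S (lmuls (eps g) (base_sub S_)) (eps g) (eps_ring_one g)
    (@eps_ring_mul g) (@eps_ring_1l g) (@eps_ring_1r g).

(* For g' the inverse of g: S_g as an \epsilon_g R-\epsilon_g' R-bimodule. *)
Fact eps_bimod_lclos g a x :
  a \in usub_set (eps_ring g) -> x \in S_ g -> a * x \in S_ g.
Proof. by move=> /eps_ringP [aR _] xg; apply: base_l. Qed.
Fact eps_bimod_rclos g g' x b :
  x \in S_ g -> b \in usub_set (eps_ring g') -> x * b \in S_ g.
Proof. by move=> xg /eps_ringP [bR _]; apply: base_r. Qed.
Fact eps_bimod_runit g g' (gg' : g' = ginv g) x :
  x \in S_ g -> x * usub_one (eps_ring g') = x.
Proof. by rewrite gg'; apply: eps_r. Qed.

Definition eps_bimod g g' (gg' : g' = ginv g) :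
    bimodule (eps_ring g) (eps_ring g') :=
  @sub_bimod S (eps_ring g) (eps_ring g') (S_ g) (@eps_bimod_lclos g)
    (@eps_l g) (@eps_bimod_rclos g g') (eps_bimod_runit gg').

(* \epsilon_g S_k as an R-bimodule. *)
Fact eps_comp_lclos g k a x :
  a \in base_sub S_ -> x \in lmuls (eps g) (S_ k) ->
  a * x \in lmuls (eps g) (S_ k).
Proof.
move=> aR /asboolP [s sk /= ->]; apply/asboolP; exists (a * s) => /=.
  exact: (base_l grS).
by rewrite mulrA -eps_central // mulrA.
Qed.
Fact eps_comp_rclos g k x a :
  x \in lmuls (eps g) (S_ k) -> a \in base_sub S_ ->
  x * a \in lmuls (eps g) (S_ k).
Proof.
move=> /asboolP [s sk /= ->] aR; apply/asboolP; exists (s * a) => /=.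
  exact: (base_r grS).
by rewrite mulrA.
Qed.
Definition eps_comp_bimod g k : bimodule R R :=
  @sub_bimod S R R (lmuls (eps g) (S_ k)) (@eps_comp_lclos g k)
    (fun x _ => mul1r x) (@eps_comp_rclos g k) (fun x _ => mulr1 x).

Section LeftModule.
Variables (M : lmodType S) (M_ : G -> zmodClosed M).
Hypothesis grM : graded_lmod S_ M_.

Fact eps_lmod_clos g k a x :
  a \in base_sub S_ -> x \in lscales (eps g) (M_ k) ->
  a *: x \in lscales (eps g) (M_ k).
Proof.
move=> aR /asboolP [m mk /= ->]; apply/asboolP; exists (a *: m).
  exact: (lmod_base_l grM).
by rewrite -[RHS]/(eps g *: (a *: m)) !scalerA eps_central.
Qed.

(* \epsilon_g M_k as a left R-module. *)
Definition eps_lmod g k : lmodType R :=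
  @sub_lmod S R M (lscales (eps g) (M_ k)) (@eps_lmod_clos g k)
    (fun x _ => scale1r x).

Fact lmod_mul_in g h s m : gdom g = gcod h -> s \in S_ g -> m \in M_ h ->
  s *: m \in lscales (eps g) (M_ (gcomp g h)).
Proof.
move=> gh sg mh; apply/asboolP; exists (s *: m).
  exact: (graded_lmodM grM).
by rewrite -[RHS]/(eps g *: (s *: m)) scalerA eps_l.
Qed.

Section Map.
Variables (g h : G) (gh : gdom g = gcod h).

Definition lmod_mul_bal : balanced
  (bim_right (comp_bimod_base_comp grS (erefl (gdom g))))
  (comp_lmod grS grM gh) (eps_lmod g (gcomp g h)).
Proof.
exists (fun s m => Subgroup (lmod_mul_in gh (sub_valP s) (sub_valP m))).
- by move=> s t m; apply: val_inj; apply: scalerDl.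
- by move=> s m n; apply: val_inj; apply: scalerDr.
- by move=> s a m; apply: val_inj; apply: (esym (scalerA _ _ _)).
Defined.

(* m_{g,h} : S_g \otimes_{S_{d(g)}} M_h -> \epsilon_g M_{gh} *)
Definition lmod_mul :
    ltensor (comp_bimod_base_comp grS (erefl (gdom g)))
      (comp_lmod grS grM gh) ->
    eps_lmod g (gcomp g h) :=
  tensor_lift lmod_mul_bal.
End Map.
End LeftModule.

Section RightModule.
Variables (M : rmodType S) (M_ : G -> zmodClosed M).
Hypothesis grM : graded_rmod S_ M_.

Fact eps_rmod_clos k h x a :
  x \in rscales (M_ k) (eps h) -> a \in base_sub S_ ->
  x *:r a \in rscales (M_ k) (eps h).
Proof.
move=> /asboolP [m mk /= ->] aR; apply/asboolP; exists (m *:r a).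
  exact: (rmod_base_r grM).
by rewrite -[LHS]/((m *:r eps h) *:r a) -[RHS]/((m *:r a) *:r eps h)
  !ractsA eps_central.
Qed.

(* M_k \epsilon_h as a right R-module. *)
Definition eps_rmod k h : rmodType R :=
  @sub_rmod S R M (rscales (M_ k) (eps h)) (@eps_rmod_clos k h)
    (fun x _ => racts1 x).

Fact rmod_mul_in g h m s : gdom g = gcod h -> m \in M_ g -> s \in S_ h ->
  m *:r s \in rscales (M_ (gcomp g h)) (eps (ginv h)).
Proof.
move=> gh mg sh; apply/asboolP; exists (m *:r s).
  exact: (graded_rmodM grM).
by rewrite -[RHS]/((m *:r s) *:r eps (ginv h)) ractsA eps_r.
Qed.

Section Map.
Variables (g h : G) (gh : gdom g = gcod h).

Definition rmod_mul_bal : balanced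
  (comp_rmod grS grM (erefl (gdom g)))
  (comp_bimod_comp_base grS gh) (eps_rmod (gcomp g h) (ginv h)).
Proof.
exists (fun m s => Subgroup (rmod_mul_in gh (sub_valP m) (sub_valP s))).
- by move=> m n s; apply: val_inj; apply: ractsDl.
- by move=> m s t; apply: val_inj; apply: ractsDr.
- by move=> m a s; apply: val_inj; apply: ractsA.
Defined.

(* m'_{g,h} : M_g \otimes_{S_{d(g)}} S_h -> M_{gh} \epsilon_{h^{-1}} *)
Definition rmod_mul :
    rtensor (comp_rmod grS grM (erefl (gdom g)))
      (comp_bimod_comp_base grS gh) ->
    eps_rmod (gcomp g h) (ginv h) :=
  tensor_lift rmod_mul_bal.
End Map.
End RightModule.

Fact comp_mul_in g h s t : gdom g = gcod h -> s \in S_ g -> t \in S_ h ->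
  s * t \in lmuls (eps g) (S_ (gcomp g h)).
Proof.
move=> gh sg th; apply/asboolP; exists (s * t); first exact: gradedM.
by rewrite /= mulrA eps_l.
Qed.

Definition comp_mul_bal g h (gh : gdom g = gcod h) : balanced
  (bim_right (comp_bimod grS g)) (comp_bimod grS h)
  (eps_comp_bimod g (gcomp g h)).
Proof.
exists (fun s t => Subgroup (comp_mul_in gh (sub_valP s) (sub_valP t))).
- by move=> s t u; apply: val_inj; apply: mulrDl.
- by move=> s t u; apply: val_inj; apply: mulrDr.
- by move=> s a t; apply: val_inj; apply: (esym (mulrA _ _ _)).
Defined.

(* m_{g,h} : S_g \otimes_R S_h -> \epsilon_g S_{gh} *)
Definition comp_mul g h (gh : gdom g = gcod h) :
    btensor (comp_bimod grS g) (comp_bimod grS h) ->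
    eps_comp_bimod g (gcomp g h) :=
  tensor_lift (comp_mul_bal gh).

Fact eps_mul_in g g' s t : g' = ginv g -> s \in S_ g -> t \in S_ g' ->
  s * t \in lmuls (eps g) (base_sub S_).
Proof.
move=> -> sg tg; apply: eps_ring_in; last by rewrite mulrA eps_l.
by apply: (@comp_base _ _ _ (gcod g)); rewrite -gcompV gradedM ?gcod_inv.
Qed.

Section EpsMap.
Variables (g g' : G) (gg' : g' = ginv g) (g'g : g = ginv g').

Definition eps_mul_bal : balanced
  (bim_right (eps_bimod gg')) (eps_bimod g'g)
  (regular_bimodule (eps_ring g)).
Proof.
exists (fun s t => Subgroup (eps_mul_in gg' (sub_valP s) (sub_valP t))
                   : regular_bimodule (eps_ring g)).
- by move=> s t u; apply: val_inj; apply: mulrDl.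
- by move=> s t u; apply: val_inj; apply: mulrDr.
- by move=> s a t; apply: val_inj; apply: (esym (mulrA _ _ _)).
Defined.

(* m_{g,g'} : S_g \otimes S_g' -> \epsilon_g R for g' the inverse of g, the
   tensor product being over \epsilon_g' R. *)
Definition eps_mul :
    btensor (eps_bimod gg') (eps_bimod g'g) -> regular_bimodule (eps_ring g) :=
  tensor_lift eps_mul_bal.

(* The canonical map to the tensor product over R; it is bijective, see
   eps_tensor_base_bij. *)
Definition eps_tensor_bal : balanced
  (bim_right (eps_bimod gg')) (eps_bimod g'g)
  (btensor (comp_bimod grS g) (comp_bimod grS g')).
Proof.
refine (@Balanced _ (bim_right (eps_bimod gg')) (eps_bimod g'g)
  (btensor (comp_bimod grS g) (comp_bimod grS g'))
  (fun s t => @tens _ (bim_right (comp_bimod grS g)) (comp_bimod grS g') s t)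
  _ _ _).
- exact: (@tensDl _ (bim_right (comp_bimod grS g)) (comp_bimod grS g')).
- exact: (@tensDr _ (bim_right (comp_bimod grS g)) (comp_bimod grS g')).
move=> s a t; have [aR _] := eps_ringP (sub_valP a).
pose a' : R := Subgroup aR.
have sE :
    s *:r a = (s : bim_right (comp_bimod grS g)) *:r a' :> subgroup (S_ g).
  exact: val_inj.
have tE : a *: t = a' *: (t : comp_bimod grS g') :> subgroup (S_ g').
  exact: val_inj.
rewrite sE tE.
exact: (@tensM _ (bim_right (comp_bimod grS g)) (comp_bimod grS g') s a' t).
Defined.

Definition eps_tensor_base :
    btensor (eps_bimod gg') (eps_bimod g'g) ->
    btensor (comp_bimod grS g) (comp_bimod grS g') :=
  tensor_lift eps_tensor_bal.

Definition base_tensor_bal : balanced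
  (bim_right (comp_bimod grS g)) (comp_bimod grS g')
  (btensor (eps_bimod gg') (eps_bimod g'g)).
Proof.
refine (@Balanced _ (bim_right (comp_bimod grS g)) (comp_bimod grS g')
  (btensor (eps_bimod gg') (eps_bimod g'g))
  (fun s t => @tens _ (bim_right (eps_bimod gg')) (eps_bimod g'g) s t)
  _ _ _).
- exact: (@tensDl _ (bim_right (eps_bimod gg')) (eps_bimod g'g)).
- exact: (@tensDr _ (bim_right (eps_bimod gg')) (eps_bimod g'g)).
move=> s a t.
have aR : eps g' * sub_val a \in lmuls (eps g') (base_sub S_).
  by apply/asboolP; exists (sub_val a); first exact: sub_valP.
pose a' : eps_ring g' := Subgroup aR.
have sE : s *:r a = (s : bim_right (eps_bimod gg')) *:r a' :> subgroup (S_ g).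
  apply: val_inj => /=; rewrite [RHS]mulrA gg' eps_r //.
  exact: sub_valP.
have tE : a *: t = a' *: (t : eps_bimod g'g) :> subgroup (S_ g').
  apply: val_inj => /=; rewrite -[LHS](@eps_l g') ?[LHS]mulrA //.
  by apply: (base_l grS); exact: sub_valP.
rewrite sE tE.
exact: (@tensM _ (bim_right (eps_bimod gg')) (eps_bimod g'g) s a' t).
Defined.

Lemma eps_tensor_base_bij : bijective eps_tensor_base.
Proof.
exists (tensor_lift base_tensor_bal :
  _ -> btensor (eps_bimod gg') (eps_bimod g'g)).
  apply: (@tensor_ext _ (bim_right (eps_bimod gg')) (eps_bimod g'g)
      (btensor (eps_bimod gg') (eps_bimod g'g))) => // [u v|s t].
    by rewrite /eps_tensor_base !raddfD.
  by rewrite /eps_tensor_base !tensor_liftE.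
apply: (@tensor_ext _ (bim_right (comp_bimod grS g)) (comp_bimod grS g')
      (btensor (comp_bimod grS g) (comp_bimod grS g'))) => // [u v|s t].
  by rewrite /eps_tensor_base !raddfD.
by rewrite /eps_tensor_base !tensor_liftE.
Qed.

(* Under this identification eps_mul is the map comp_mul of degrees g, g'. *)
Lemma eps_mul_comp_mul (gd : gdom g = gcod g') t :
  sub_val (comp_mul gd (eps_tensor_base t)) = sub_val (eps_mul t).
Proof.
have valD (N : zmodClosed S) (x y : subgroup N) :
  sub_val (x + y) = sub_val x + sub_val y by [].
move: t; apply: (@tensor_ext _ (bim_right (eps_bimod gg')) (eps_bimod g'g) S).
- by move=> u v; rewrite /comp_mul /eps_tensor_base !raddfD; apply: valD.
- by move=> u v; rewrite /eps_mul !raddfD; apply: valD.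
by move=> s u; rewrite /comp_mul /eps_tensor_base /eps_mul !tensor_liftE.
Qed.
End EpsMap.
End EpsilonStrong.

Arguments lmod_mul {G S S_} grS esS {eps} epsP {M M_} grM {g h} gh t.
Arguments rmod_mul {G S S_} grS esS {eps} epsP {M M_} grM {g h} gh t.
Arguments comp_mul {G S S_} grS esS {eps} epsP {g h} gh t.
Arguments eps_mul {G S S_} grS esS {eps} epsP {g g'} gg' g'g t.

(* Main.v *)
Require Import Defs.
From mathcomp Require Import all_boot all_algebra.
From mathcomp Require Import boolp.
Import GRing.Theory.
Local Open Scope ring_scope.

(** All four assertions come from one formula.  Since epsilon_g lies in
    S_g S_{g^-1}, one may write epsilon_g = sum_i u_i v_i with u_i in S_g and
    v_i in S_{g^-1}, and epsilon_g acts as the identity on S_g and on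
    epsilon_g M_{gh} ([eps_sum], [eps_l]).  Hence x = sum_i u_i (v_i x) for x
    in S_g, with v_i x in S_{g^-1} S_g, which lies in the ring over which the
    tensor product is formed: the u_i and the maps x |-> v_i x form a finite
    dual basis of the right module S_g.  The inverse of s (x) m |-> s m is then
      z |-> sum_i u_i (x) v_i z,
    because sum_i u_i v_i z = epsilon_g z = z and
      sum_i u_i (x) v_i s m = sum_i u_i (v_i s) (x) m = s (x) m.
    The second computation is the only one that takes place in a tensor
    product, so it is done once, for an arbitrary balanced map
    ([tensor_lift_bij_l]); (a), (c) and the two bijections of (d) are instances
    differing in the coefficient ring and the target.  Assertion (b) is the
    mirror image ([tensor_lift_bij_r]), with
    epsilon_{h^-1} = sum_i u_i v_i, u_i in S_{h^-1}, v_i in S_h, and inverse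
    z |-> sum_i z u_i (x) v_i.

    In (c), epsilon_g S_{gh} = S_{gh} epsilon_{h^-1} because the axioms identify
    both sides with S_g S_h ([eps_comp_sym]).  The compatibility conditions
    of (d) are the associativity of S. *)

(** * Lifts of balanced maps to tensor products *)

(** The [u i] and [f i] form a finite dual basis of [X], so a tensor is
    determined by its contractions with the [f i]: [x (x) y] is the sum of the
    [u i (x) f i x *: y].  The [k i] compute these contractions from the value
    of [b], which makes [z |-> sum_i u i (x) k i z] a left inverse. *)
Lemma tensor_lift_bij_l (A : pzRingType) (X : rmodType A) (Y : lmodType A)
    (Z : zmodType) (b : balanced X Y Z) (I : Type) (r : seq I)
    (u : I -> X) (f : I -> X -> A) (k : I -> Z -> Y) :
  (forall x, x = \sum_(i <- r) racts (u i) (f i x)) ->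
  (forall i, {morph k i : z z' / z + z'}) ->
  (forall i x y, k i (b x y) = f i x *: y) ->
  (forall z, \sum_(i <- r) b (u i) (k i z) = z) ->
  bijective (tensor_lift b).
Proof.
move=> uf kD kb bk.
have tens_suml (g : I -> X) y :
    tens (\sum_(i <- r) g i) y = \sum_(i <- r) tens (g i) y.
  by apply: (big_morph (fun x => tens x y)) => [x x'|];
    rewrite ?tensDl ?tens0l.
exists (fun z => \sum_(i <- r) tens (u i) (k i z)) => [t|z]; last first.
  by rewrite raddf_sum -[RHS]bk; apply: eq_bigr => i _; apply: tensor_liftE.
move: t; apply: tensor_ext => [t t'|//|x y].
  by rewrite raddfD -big_split; apply: eq_bigr => i _; rewrite kD tensDr.
rewrite tensor_liftE [in RHS](uf x) tens_suml.
by apply: eq_bigr => i _; rewrite kb tensM.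
Qed.

(** Mirror image of [tensor_lift_bij_l], the dual basis being one of the left
    module [Y]. *)
Lemma tensor_lift_bij_r (A : pzRingType) (X : rmodType A) (Y : lmodType A)
    (Z : zmodType) (b : balanced X Y Z) (I : Type) (r : seq I)
    (v : I -> Y) (f : I -> Y -> A) (k : I -> Z -> X) :
  (forall y, y = \sum_(i <- r) f i y *: v i) ->
  (forall i, {morph k i : z z' / z + z'}) ->
  (forall i x y, k i (b x y) = racts x (f i y)) ->
  (forall z, \sum_(i <- r) b (k i z) (v i) = z) ->
  bijective (tensor_lift b).
Proof.
move=> vf kD kb bk.
have tens_sumr (g : I -> Y) x :
    tens x (\sum_(i <- r) g i) = \sum_(i <- r) tens x (g i).
  apply: (big_morph (tens x)) => [y y'|]; first by rewrite tensDr.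
  by apply: (addrI (tens x 0)); rewrite -tensDr !addr0.
exists (fun z => \sum_(i <- r) tens (k i z) (v i)) => [t|z]; last first.
  by rewrite raddf_sum -[RHS]bk; apply: eq_bigr => i _; apply: tensor_liftE.
move: t; apply: tensor_ext => [t t'|//|x y].
  by rewrite raddfD -big_split; apply: eq_bigr => i _; rewrite kD tensDl.
rewrite tensor_liftE [in RHS](vf y) tens_sumr.
by apply: eq_bigr => i _; rewrite kb tensM.
Qed.

Lemma tensor_lift_linear (B A : pzRingType) (P : bimodule B A) (Y : lmodType A)
    (Z : lmodType B) (b : balanced (bim_right P) Y Z) :
  (forall c (x : P) y, b (c *: x : P) y = c *: b x y) ->
  linear (tensor_lift b : ltensor P Y -> Z).
Proof.
move=> bZ c t t'; rewrite [LHS]raddfD; congr (_ + _); move: t.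
apply: (@tensor_ext _ (bim_right P) Y Z) => [t u|t u|x y].
- rewrite -[RHS]raddfD; congr (tensor_lift b _).
  exact: (scalerDr c (t : ltensor P Y) u).
- by rewrite [tensor_lift _ _]raddfD scalerDr.
rewrite -[LHS]/(tensor_lift b (ltensor_act c (tens x y))).
by rewrite ltensor_actE !tensor_liftE bZ.
Qed.

Lemma tensor_lift_racts (A C : pzRingType) (X : rmodType A) (Q : bimodule A C)
    (Z : rmodType C) (b : balanced X Q Z) :
  (forall x (y : Q) c, b x (bract y c) = racts (b x y) c) ->
  forall (t : rtensor X Q) c,
    tensor_lift b (racts t c) = racts (tensor_lift b t) c.
Proof.
move=> bZ t c; move: t.
apply: (@tensor_ext _ X Q Z) => [t u|t u|x y].
- rewrite -[RHS]raddfD; congr (tensor_lift b _).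
  exact: (ractsDl (t : rtensor X Q) u c).
- by rewrite [tensor_lift _ _]raddfD ractsDl.
rewrite -[LHS]/(tensor_lift b (rtensor_act (c : C^c) (tens x y))).
by rewrite rtensor_actE !tensor_liftE bZ.
Qed.

Lemma tensor_lift_bract (B A C : pzRingType) (P : bimodule B A)
    (Q : bimodule A C) (Z : bimodule B C) (b : balanced (bim_right P) Q Z) :
  (forall x (y : Q) c, b x (bract y c) = bract (b x y) c) ->
  forall (t : btensor P Q) c,
    tensor_lift b (bract t c) = bract (tensor_lift b t) c.
Proof.
exact: (@tensor_lift_racts A C (bim_right P) Q (bim_right Z)).
Qed.

(** * The local identities as sums of products *)

Lemma gcompK (G : groupoid) (g h : G) : gdom g = gcod h ->
  gcomp (ginv g) (gcomp g h) = h.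
Proof.
by move=> gh; rewrite gcompA ?gdom_inv // gcompVl gh gcomp1l.
Qed.

Lemma gcompKr (G : groupoid) (g h : G) : gdom g = gcod h ->
  gcomp (gcomp g h) (ginv h) = g.
Proof.
by move=> gh; rewrite -gcompA ?gcod_inv // gcompV -gh gcomp1r.
Qed.

Section EpsilonStrong.
Variables (G : groupoid) (S : pzRingType) (S_ : G -> zmodClosed S).
Hypothesis grS : graded_ring S_.
Hypothesis esS : epsilon_strong S_.
Variable eps : G -> S.
Hypothesis epsP : forall g, identity_of (mulset (S_ g) (S_ (ginv g))) (eps g).
Implicit Types g h : G.

(** [g'] is kept apart from [ginv g] so that the second factors can have type
    [S_ h] when [eps (ginv h)] is decomposed. *)
Lemma eps_sum g g' (gg' : g' = ginv g) :
  exists r : seq (subgroup (S_ g) * subgroup (S_ g')),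
    eps g = \sum_(p <- r) sub_val p.1 * sub_val p.2.
Proof.
rewrite {}gg'; move: (epsP g).1; move: (eps g).
apply: mulset_ind => [|x y|a b aS bS].
- by exists [::]; rewrite big_nil.
- by move=> [r ->] [r' ->]; exists (r ++ r'); rewrite big_cat.
by exists [:: (Subgroup aS, Subgroup bS)]; rewrite big_seq1.
Qed.

(** Both sides equal S_g S_h: by the two axioms it contains
    epsilon_g S_{gh} and S_{gh} epsilon_{h^-1}, and it is contained in both
    because epsilon_g and epsilon_{h^-1} fix S_g and S_h. *)
Lemma eps_comp_sym g h : gdom g = gcod h ->
  lmuls (eps g) (S_ (gcomp g h)) =i rmuls (S_ (gcomp g h)) (eps (ginv h)).
Proof.
move=> gh x.
have xgh : x \in mulset (S_ g) (S_ h) -> x \in S_ (gcomp g h).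
  move: x; apply: mulset_ind => [|x y|a b aS bS]; first exact: rpred0.
    exact: rpredD.
  exact: (gradedM grS).
have [SSl SSr] := esS.2 g h gh.
apply/asboolP/asboolP => [[s sS /= xE]|[s sS /= xE]].
  have xm : x \in mulset (S_ g) (S_ h).
    by rewrite SSl xE mulset_mul // (epsP g).1.
  exists x => /=; first exact: xgh.
  move: x xm {xE xgh}; apply: mulset_ind => [|x y|a b aS bS].
  - by rewrite mul0r.
  - by rewrite mulrDl => <- <-.
  - by rewrite -mulrA (eps_r grS esS epsP).
have xm : x \in mulset (S_ g) (S_ h).
  have [r er] := eps_sum _ _ (esym (ginvK h)).
  rewrite xE er SSr mulr_sumr.
  apply/asboolP; exists [seq (s * sub_val p.1, sub_val p.2) | p <- r].
    move=> q /mapP [p _ ->] /=; by rewrite mulset_mul ?sub_valP.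
  by rewrite big_map; apply: eq_bigr => p _; rewrite mulrA.
exists x => /=; first exact: xgh.
move: x xm {xE xgh}; apply: mulset_ind => [|x y|a b aS bS].
- by rewrite mulr0.
- by rewrite mulrDr => <- <-.
- by rewrite mulrA (eps_l grS esS epsP).
Qed.

(** * Graded left and right modules *)

Section LeftModule.
Variables (M : lmodType S) (M_ : G -> zmodClosed M).
Hypothesis grM : graded_lmod S_ M_.

Lemma lscales_epsP g k m : m \in lscales (eps g) (M_ k) ->
  m \in M_ k /\ eps g *: m = m.
Proof.
move=> /asboolP [n nM /= ->]; split.
  apply: (lmod_base_l grM) nM; exact: (eps_base esS epsP).
by rewrite scalerA (eps_idem epsP).
Qed.

(** The dual basis of S_g over S_{d(g)} consists of the [u_i] and the maps
    [x |-> v_i x], where epsilon_g = sum_i u_i v_i; multiplication by v_i also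
    maps M_{gh} to M_h, which yields the inverse. *)
Lemma lmod_mul_bij g h (gh : gdom g = gcod h) :
  bijective (lmod_mul grS esS epsP grM gh).
Proof.
have [r er] := eps_sum g _ erefl.
have fP (p : subgroup (S_ g) * subgroup (S_ (ginv g))) (x : subgroup (S_ g)) :
    sub_val p.2 * sub_val x \in S_ (gid (gdom g)).
  by rewrite -gcompVl (gradedM grS) ?gdom_inv ?sub_valP.
have kP (p : subgroup (S_ g) * subgroup (S_ (ginv g)))
    (z : subgroup (lscales (eps g) (M_ (gcomp g h)))) :
    sub_val p.2 *: sub_val z \in M_ h.
  have [zM _] := lscales_epsP _ _ _ (sub_valP z).
  have := graded_lmodM grM _ (sub_valP p.2) zM.
  by rewrite gcompK // gdom_inv gcod_comp //; apply.
apply: (tensor_lift_bij_l _ _ _ _ (lmod_mul_bal grS esS epsP grM gh) _ r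
  (fun p => p.1) (fun p x => Subgroup (fP p x)) (fun p z => Subgroup (kP p z))).
- move=> x; apply: val_inj; rewrite raddf_sum /=.
  rewrite -[LHS](eps_l grS esS epsP (sub_valP x)) er mulr_suml.
  by apply: eq_bigr => p _; rewrite -[LHS]mulrA.
- by move=> p z z'; apply: val_inj; apply: scalerDr.
- by move=> p x y; apply: val_inj; apply: scalerA.
move=> z; apply: val_inj; rewrite raddf_sum /=.
have [_ zE] := lscales_epsP _ _ _ (sub_valP z).
move: (sub_val z) zE => m zE; rewrite -[RHS]zE er scaler_suml.
by apply: eq_bigr => p _; rewrite -scalerA.
Qed.

Lemma lmod_mul_iso g h (gh : gdom g = gcod h) :
  lmod_iso (lmod_mul grS esS epsP grM gh).
Proof.
split; last exact: lmod_mul_bij.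
apply: tensor_lift_linear => c x y; apply: val_inj.
exact: (esym (scalerA _ _ _)).
Qed.
End LeftModule.

Section RightModule.
Variables (M : rmodType S) (M_ : G -> zmodClosed M).
Hypothesis grM : graded_rmod S_ M_.

Lemma rscales_epsP k g m : m \in rscales (M_ k) (eps g) ->
  m \in M_ k /\ racts m (eps g) = m.
Proof.
move=> /asboolP [n nM /= ->]; split.
  apply: (rmod_base_r grM) nM _; exact: (eps_base esS epsP).
by rewrite -[n in LHS]racts1 -/(racts _ _) !ractsA mul1r (eps_idem epsP).
Qed.

(** The dual basis is now one of the left S_{d(g)}-module S_h, made of the [v_i]
    and the maps [x |-> x u_i], where epsilon_{h^-1} = sum_i u_i v_i. *)
Lemma rmod_mul_bij g h (gh : gdom g = gcod h) :
  bijective (rmod_mul grS esS epsP grM gh).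
Proof.
have [r er] := eps_sum _ _ (esym (ginvK h)).
have fP (p : subgroup (S_ (ginv h)) * subgroup (S_ h))
    (x : subgroup (S_ h)) : sub_val x * sub_val p.1 \in S_ (gid (gdom g)).
  by rewrite gh -gcompV (gradedM grS) ?gcod_inv ?sub_valP.
have kP (p : subgroup (S_ (ginv h)) * subgroup (S_ h))
    (z : subgroup (rscales (M_ (gcomp g h)) (eps (ginv h)))) :
    racts (sub_val z) (sub_val p.1) \in M_ g.
  have [zM _] := rscales_epsP _ _ _ (sub_valP z).
  have := graded_rmodM grM _ zM (sub_valP p.1).
  by rewrite gcompKr // gcod_inv gdom_comp //; apply.
apply: (tensor_lift_bij_r _ _ _ _ (rmod_mul_bal grS esS epsP grM gh) _ r
  (fun p => p.2) (fun p x => Subgroup (fP p x))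
  (fun p z => Subgroup (kP p z))).
- move=> x; apply: val_inj; rewrite raddf_sum /=.
  rewrite -[LHS](eps_r grS esS epsP (sub_valP x)) er mulr_sumr.
  by apply: eq_bigr => p _; rewrite [LHS]mulrA.
- by move=> p z z'; apply: val_inj; apply: ractsDl.
- by move=> p x y; apply: val_inj; apply: ractsA.
move=> z; apply: val_inj; rewrite raddf_sum /=.
have [_ zE] := rscales_epsP _ _ _ (sub_valP z).
move: (sub_val z) zE => m zE; rewrite -[RHS]zE er /racts (@scaler_suml S^c).
by apply: eq_bigr => p _; apply: ractsA.
Qed.

Lemma rmod_mul_iso g h (gh : gdom g = gcod h) :
  rmod_iso (rmod_mul grS esS epsP grM gh).
Proof.
split; last exact: rmod_mul_bij.
  exact: raddfD.
apply: tensor_lift_racts => x y c; apply: val_inj.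
exact: (esym (ractsA _ _ _)).
Qed.
End RightModule.

(** * The ring itself and the equivalence data *)

Lemma lmuls_epsP g k s : s \in lmuls (eps g) (S_ k) ->
  s \in S_ k /\ eps g * s = s.
Proof.
move=> /asboolP [t tS /= ->]; split.
  apply: (base_l grS) tS; exact: (eps_base esS epsP).
by rewrite mulrA (eps_idem epsP).
Qed.

(** As in [lmod_mul_bij], with the v_i x now regarded as elements of R. *)
Lemma comp_mul_bij g h (gh : gdom g = gcod h) :
  bijective (comp_mul grS esS epsP gh).
Proof.
have [r er] := eps_sum g _ erefl.
have fP (p : subgroup (S_ g) * subgroup (S_ (ginv g))) (x : subgroup (S_ g)) :
    sub_val p.2 * sub_val x \in base_sub S_.
  apply: (@comp_base _ _ _ (gdom g)).
  by rewrite -gcompVl (gradedM grS) ?gdom_inv ?sub_valP.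
have kP (p : subgroup (S_ g) * subgroup (S_ (ginv g)))
    (z : subgroup (lmuls (eps g) (S_ (gcomp g h)))) :
    sub_val p.2 * sub_val z \in S_ h.
  have [zS _] := lmuls_epsP _ _ _ (sub_valP z).
  have := gradedM grS _ (sub_valP p.2) zS.
  by rewrite gcompK // gdom_inv gcod_comp //; apply.
apply: (tensor_lift_bij_l _ _ _ _ (comp_mul_bal grS esS epsP gh) _ r
  (fun p => p.1) (fun p x => Subgroup (fP p x)) (fun p z => Subgroup (kP p z))).
- move=> x; apply: val_inj; rewrite raddf_sum /=.
  rewrite -[LHS](eps_l grS esS epsP (sub_valP x)) er mulr_suml.
  by apply: eq_bigr => p _; rewrite -[LHS]mulrA.
- by move=> p z z'; apply: val_inj; apply: mulrDr.
- by move=> p x y; apply: val_inj; apply: mulrA.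
move=> z; apply: val_inj; rewrite raddf_sum /=.
have [_ zE] := lmuls_epsP _ _ _ (sub_valP z).
move: (sub_val z) zE => m zE; rewrite -[RHS]zE er mulr_suml.
by apply: eq_bigr => p _; rewrite -mulrA.
Qed.

Lemma comp_mul_iso g h (gh : gdom g = gcod h) :
  bimod_iso (comp_mul grS esS epsP gh).
Proof.
split; last exact: comp_mul_bij.
  apply: tensor_lift_linear => c x y; apply: val_inj.
  exact: (esym (mulrA _ _ _)).
apply: tensor_lift_bract => x y c; apply: val_inj.
exact: mulrA.
Qed.

(** As in [lmod_mul_bij], the v_i x lying in epsilon_{g^-1} R.  Applied to
    [g'] and [g], this also gives the second bijection. *)
Lemma eps_mul_bij g g' (gg' : g' = ginv g) (g'g : g = ginv g') :
  bijective (eps_mul grS esS epsP gg' g'g).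
Proof.
have [r er] := eps_sum g g' gg'.
have fP (p : subgroup (S_ g) * subgroup (S_ g')) (x : subgroup (S_ g)) :
    sub_val p.2 * sub_val x \in usub_set (eps_ring grS esS epsP g').
  by apply: (eps_mul_in grS esS epsP g'g); rewrite ?sub_valP.
have kP (p : subgroup (S_ g) * subgroup (S_ g'))
    (z : eps_ring grS esS epsP g) : sub_val p.2 * sub_val z \in S_ g'.
  have [zR _] := eps_ringP grS esS epsP (sub_valP z).
  by apply: (base_r grS) => //; apply: sub_valP.
apply: (tensor_lift_bij_l _ _ _ _ (eps_mul_bal grS esS epsP gg' g'g) _ r
  (fun p => p.1) (fun p x => Subgroup (fP p x)) (fun p z => Subgroup (kP p z))).
- move=> x; apply: val_inj; rewrite raddf_sum /=.
  rewrite -[LHS](eps_l grS esS epsP (sub_valP x)) er mulr_suml.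
  by apply: eq_bigr => p _; rewrite -[LHS]mulrA.
- by move=> p z z'; apply: val_inj; apply: mulrDr.
- by move=> p x y; apply: val_inj; apply: mulrA.
move=> z; apply: val_inj; rewrite raddf_sum /=.
have [_ zE] := eps_ringP grS esS epsP (sub_valP z).
move: (sub_val z) zE => m zE; rewrite -[RHS]zE er mulr_suml.
by apply: eq_bigr => p _; rewrite -mulrA.
Qed.

Lemma eps_mul_iso g g' (gg' : g' = ginv g) (g'g : g = ginv g') :
  bimod_iso (eps_mul grS esS epsP gg' g'g).
Proof.
split; last exact: eps_mul_bij.
  apply: tensor_lift_linear => c x y; apply: val_inj.
  exact: (esym (mulrA _ _ _)).
apply: tensor_lift_bract => x y c; apply: val_inj.
exact: mulrA.
Qed.

(** Stated for any mutually inverse [g] and [g'], so that exchanging them gives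
    the other compatibility condition. *)
Lemma eps_mul_assoc g g' (gg' : g' = ginv g) (g'g : g = ginv g')
    (p p' : eps_bimod grS esS epsP gg') (q : eps_bimod grS esS epsP g'g) :
  (eps_mul grS esS epsP gg' g'g
     (tens (p : bim_right (eps_bimod grS esS epsP gg')) q)
     : eps_ring grS esS epsP g) *: p' =
  bract p (eps_mul grS esS epsP g'g gg'
     (tens (q : bim_right (eps_bimod grS esS epsP g'g)) p')).
Proof.
rewrite /eps_mul !tensor_liftE; apply: val_inj.
exact: (esym (mulrA _ _ _)).
Qed.
End EpsilonStrong.


Theorem proposition48 (G : groupoid) (S : pzRingType)
    (S_ : G -> zmodClosed S)
    (grS : graded_ring S_) (esS : epsilon_strong S_)
    (eps : G -> S)
    (epsP : forall g : G,
       identity_of (mulset (S_ g) (S_ (ginv g))) (eps g)) :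
  (forall (g h : G) (gh : gdom g = gcod h),
     [/\ (* (a) *)
         forall (M : lmodType S) (M_ : G -> zmodClosed M)
           (grM : graded_lmod S_ M_),
           lmod_iso (lmod_mul grS esS epsP grM gh),
         (* (b) *)
         forall (M : rmodType S) (M_ : G -> zmodClosed M)
           (grM : graded_rmod S_ M_),
           rmod_iso (rmod_mul grS esS epsP grM gh)
       & (* (c) *)
         lmuls (eps g) (S_ (gcomp g h)) =i rmuls (S_ (gcomp g h)) (eps (ginv h))
         /\ bimod_iso (comp_mul grS esS epsP gh)]) /\
  (* (d) *)
  (forall g : G,
     let gg' : ginv g = ginv g := erefl in
     let g'g : g = ginv (ginv g) := esym (ginvK g) in
     @equivalence_data
       (eps_ring grS esS epsP g) (eps_ring grS esS epsP (ginv g))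
       (eps_bimod grS esS epsP gg') (eps_bimod grS esS epsP g'g)
       (eps_mul grS esS epsP gg' g'g) (eps_mul grS esS epsP g'g gg')).
Proof.
split=> [g h gh|g gg' g'g].
  split=> [M M_ grM|M M_ grM|]; [exact: lmod_mul_iso|exact: rmod_mul_iso|split].
    exact: eps_comp_sym.
  exact: comp_mul_iso.
split; [exact: eps_mul_iso|exact: eps_mul_iso|exact: eps_mul_assoc|].
exact: eps_mul_assoc.
Qed.
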